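(* Let $A\in\mathbb{R}^{n\times n}$ be symmetric and let $u\in\mathbb{R}^n$ satisfy $u^TAu\neq 0$. The homogeneous Rayleigh quotient $\alpha$ of $A$ at $u$ solves $$(u^TAu)\,\alpha^2+(u^Tu-u^TA^2u)\,\alpha-(u^TAu)=0$$ and satisfies $\alpha\cdot u^TAu>0$. In addition, $\alpha$ is a harmonic Rayleigh quotient with target $\tau=-\alpha^{-1}$, that is, $\alpha=\widetilde\theta_{\tau}$ for $\tau=-\alpha^{-1}$.
   Context: $\|\cdot\|$ is the Euclidean norm. $\mathbb{P}_1(\mathbb{R})$ is the real projective line, i.e. $\mathbb{R}^2\setminus\{0\}$ modulo multiplication by nonzero scalars. For $u^TAu\ne0$ the minimizer $(\alpha_1,\alpha_2)\in\mathbb{P}_1(\mathbb{R})$ of $\frac{\|\alpha_1u-\alpha_2Au\|}{\sqrt{\alpha_1^2+\alpha_2^2}}$ is unique and has $\alpha_2\ne0$; the homogeneous Rayleigh quotient of $A$ at $u$ is $\alpha=\alpha_1/\alpha_2$, explicitly $$\alpha=\frac{1}{2\,u^TAu}\Big[u^TA^2u-u^Tu+\sqrt{(u^TA^2u-u^Tu)^2+4(u^TAu)^2}\Big].$$ For $\tau\in\mathbb{R}$, the harmonic Rayleigh quotient with target $\tau$ is $\widetilde\theta_\tau=\frac{u^T(A-\tau I)Au}{u^T(A-\tau I)u}$, defined when the denominator is nonzero. *)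

(* Defs.v *)
From HB Require Import structures.
From mathcomp Require Import all_boot all_order all_algebra.
From mathcomp Require Import boolp classical_sets reals.

Set Implicit Arguments.
Unset Strict Implicit.
Unset Printing Implicit Defensive.
Import Order.TTheory GRing.Theory Num.Theory.
Local Open Scope classical_set_scope.
Local Open Scope ring_scope.

(* The Euclidean norm; the norm that MathComp-Analysis puts on matrices is the
   sup norm. *)
Definition enorm (R : realType) (n : nat) (u : 'cV[R]_n) : R :=
  Num.sqrt (\sum_i u i 0 ^+ 2).

(* u^T B u *)
Definition qform (R : realType) (n : nat) (B : 'M[R]_n) (u : 'cV[R]_n) : R :=
  (u^T *m B *m u) 0 0.

Definition hom_residual (R : realType) (n : nat) (A : 'M[R]_n) (u : 'cV[R]_n)
    (p : R * R) : R :=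
  enorm (p.1 *: u - p.2 *: (A *m u)) / Num.sqrt (p.1 ^+ 2 + p.2 ^+ 2).

(* Minimizers over the real projective line.  A point of P_1(R) is given by any
   of its pairs p != 0 of homogeneous coordinates; hom_residual takes the same
   value on all of them. *)
Definition hom_minimizers (R : realType) (n : nat) (A : 'M[R]_n)
    (u : 'cV[R]_n) : set (R * R) :=
  [set p : R * R | p != 0 /\
    forall q : R * R, q != 0 -> hom_residual A u p <= hom_residual A u q].

(* The ratio alpha_1 / alpha_2 of the minimizer (alpha_1, alpha_2).  If
   qform A u != 0, the minimizer is unique as a projective point and has
   alpha_2 != 0, so that the ratio depends neither on the pair chosen by xget
   nor on its default value. *)
Definition homRQ (R : realType) (n : nat) (A : 'M[R]_n) (u : 'cV[R]_n) : R :=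
  let p := xget 0 (hom_minimizers A u) in p.1 / p.2.

(* A relation, because the quotient is only defined for a nonzero
   denominator. *)
Definition is_harmonicRQ (R : realType) (n : nat) (A : 'M[R]_n) (u : 'cV[R]_n)
    (tau theta : R) : Prop :=
  qform (A - tau%:M) u != 0 /\
  theta = qform ((A - tau%:M) *m A) u / qform (A - tau%:M) u.

(* Main.v *)
(** The squared residual at [(x, y)] is the Rayleigh quotient of the 2x2
    symmetric matrix [[a, -b], [-b, c]] with [a = u^T u], [b = u^T A u] and
    [c = u^T A^2 u].  Let [l] be its smallest eigenvalue and [m = a - l]; since
    [b != 0], [m] is the positive root of [m * (m + c - a) = b ^+ 2].
    Completing the square,
      [m * (x^2 a - 2 x y b + y^2 c - l (x^2 + y^2)) = (m x - b y)^2],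
    so the minimizers are exactly the nonzero solutions of [m x = b y], and the
    homogeneous Rayleigh quotient is [b / m].  The three claims are then
    rational identities in [a, b, c, m]. *)
Require Import Defs.
From HB Require Import structures.
From mathcomp Require Import all_boot all_order all_algebra.
From mathcomp Require Import boolp classical_sets reals.
From mathcomp Require Import ring lra.
Import Order.TTheory GRing.Theory Num.Theory.
Local Open Scope ring_scope.

Lemma sqr_enorm (R : realType) (n : nat) (v : 'cV[R]_n) :
  enorm v ^+ 2 = (v^T *m v) 0 0.
Proof.
rewrite sqr_sqrtr; last by apply: sumr_ge0 => i _; exact: sqr_ge0.
by rewrite mxE; apply: eq_bigr => i _; rewrite mxE expr2.
Qed.

Lemma sqr_enorm_lincomb (R : realType) (n : nat) (A : 'M[R]_n) (u : 'cV[R]_n)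
    (x y : R) : A^T = A ->
  enorm (x *: u - y *: (A *m u)) ^+ 2 =
    x ^+ 2 * (u^T *m u) 0 0 - 2 * x * y * qform A u
      + y ^+ 2 * qform (A *m A) u.
Proof.
move=> A_sym; rewrite sqr_enorm /qform.
have -> : (x *: u - y *: (A *m u))^T = x *: u^T - y *: (u^T *m A).
  by rewrite -[in RHS]A_sym -trmx_mul; apply/matrixP => i j; rewrite !mxE.
rewrite mulmxBl !mulmxBr -!scalemxAl -!scalemxAr !mulmxA !mxE.
ring.
Qed.

Lemma sqrD_sqr_gt0 (R : realDomainType) (p : R * R) :
  p != 0 -> 0 < p.1 ^+ 2 + p.2 ^+ 2.
Proof.
case: p => x y p_neq0 /=; rewrite lt0r addr_ge0 ?sqr_ge0 // andbT.
by apply: contraNN p_neq0; rewrite paddr_eq0 ?sqr_ge0 // !sqrf_eq0.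
Qed.

(** Squaring preserves the order of the nonnegative residuals, and the denominators are positive, so
    all square roots and quotients can be cleared. *)
Lemma hom_residual_le (R : realType) (n : nat) (A : 'M[R]_n) (u : 'cV[R]_n)
    (p q : R * R) : p != 0 -> q != 0 ->
  (hom_residual A u p <= hom_residual A u q) =
  (enorm (p.1 *: u - p.2 *: (A *m u)) ^+ 2 * (q.1 ^+ 2 + q.2 ^+ 2) <=
   enorm (q.1 *: u - q.2 *: (A *m u)) ^+ 2 * (p.1 ^+ 2 + p.2 ^+ 2)).
Proof.
move=> /sqrD_sqr_gt0 p_gt0 /sqrD_sqr_gt0 q_gt0.
have res_ge0 r : 0 <= hom_residual A u r by rewrite divr_ge0 ?sqrtr_ge0.
rewrite -ler_sqr ?nnegrE // !expr_div_n.
rewrite (sqr_sqrtr (ltW p_gt0)) (sqr_sqrtr (ltW q_gt0)).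
by rewrite ler_pdivrMr // mulrAC ler_pdivlMr.
Qed.

(** The two roots in [m] have product [- b ^+ 2 < 0], so the larger one is positive. *)
Lemma pos_quadratic_root (R : rcfType) (d b : R) : b != 0 ->
  exists2 m : R, 0 < m & m * (m + d) = b ^+ 2.
Proof.
move=> b_neq0; have b2_gt0 : 0 < b ^+ 2 by rewrite exprn_even_gt0.
set s := Num.sqrt (d ^+ 2 + 4 * b ^+ 2).
have s2 : s ^+ 2 = d ^+ 2 + 4 * b ^+ 2.
  by rewrite sqr_sqrtr // addr_ge0 ?sqr_ge0 // mulr_ge0 ?ler0n ?sqr_ge0.
have d_lt_s : d < s.
  apply: le_lt_trans (ler_norm d) _.
  rewrite -ltr_sqr ?nnegrE ?normr_ge0 ?sqrtr_ge0 // s2 real_normK ?num_real //.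
  by lra.
exists ((s - d) / 2); first by lra.
have -> : (s - d) / 2 * ((s - d) / 2 + d) = (s ^+ 2 - d ^+ 2) / 4 by field.
by rewrite s2; field.
Qed.

Section HomogeneousRayleighQuotient.

Variables (R : realType) (n : nat) (A : 'M[R]_n) (u : 'cV[R]_n).
Hypothesis A_sym : A^T = A.

Let a := (u^T *m u) 0 0.
Let b := qform A u.
Let c := qform (A *m A) u.

Variable m : R.
Hypothesis m_gt0 : 0 < m.
Hypothesis m_root : m * (m + (c - a)) = b ^+ 2.

Let complete_square (x y : R) :
  m * enorm (x *: u - y *: (A *m u)) ^+ 2 =
    m * (a - m) * (x ^+ 2 + y ^+ 2) + (m * x - b * y) ^+ 2.
Proof.
rewrite sqr_enorm_lincomb // -/a -/b -/c.
(* Isolating [m * (m + (c - a))] in the [y ^+ 2] term lets [m_root] turn that term into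
   [(b * y) ^+ 2]. *)
have -> : m * (x ^+ 2 * a - 2 * x * y * b + y ^+ 2 * c) =
    m * (a - m) * (x ^+ 2 + y ^+ 2) + (m * x) ^+ 2 - 2 * (m * x) * (b * y)
      + y ^+ 2 * (m * (m + (c - a))) by ring.
by rewrite m_root; ring.
Qed.

(** After multiplication by [m], completing the square leaves the same eigenvalue term on both
    sides, and it cancels. *)
Let residual_leE (p q : R * R) : p != 0 -> q != 0 ->
  (hom_residual A u p <= hom_residual A u q) =
  ((m * p.1 - b * p.2) ^+ 2 * (q.1 ^+ 2 + q.2 ^+ 2) <=
   (m * q.1 - b * q.2) ^+ 2 * (p.1 ^+ 2 + p.2 ^+ 2)).
Proof.
move=> p_neq0 q_neq0; rewrite hom_residual_le // -(ler_pM2l m_gt0).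
rewrite !(mulrA m (_ ^+ 2)).
by rewrite !complete_square !mulrDl (mulrAC _ (p.1 ^+ 2 + _)) lerD2l.
Qed.

Lemma hom_minimizersP (p : R * R) :
  hom_minimizers A u p <-> p != 0 /\ m * p.1 = b * p.2.
Proof.
split=> [[p_neq0 p_min]|[p_neq0 p_eq]]; split=> //; last first.
  move=> q q_neq0; rewrite residual_leE // p_eq subrr expr0n mul0r.
  by rewrite mulr_ge0 ?sqr_ge0 // ltW // sqrD_sqr_gt0.
(* Comparing [p] with [(b, m)], where the linear form [m x - b y] vanishes, forces the form to
   vanish at [p] too. *)
have bm_neq0 : (b, m) != 0 :> R * R by rewrite xpair_eqE (gt_eqF m_gt0) andbF.
have := p_min _ bm_neq0; rewrite residual_leE //= (mulrC m b) subrr expr0n mul0r.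
rewrite pmulr_lle0; last exact: sqrD_sqr_gt0 bm_neq0.
by rewrite real_exprn_even_le0 ?num_real //= subr_eq0 => /eqP.
Qed.

Lemma homRQE : homRQ A u = b / m.
Proof.
have m_neq0 : m != 0 by rewrite gt_eqF.
have bm_min : hom_minimizers A u (b, m).
  by apply/hom_minimizersP; rewrite xpair_eqE (negbTE m_neq0) andbF /= mulrC.
(* The default value of [xget] is excluded because [(b, m)] is a minimizer. *)
rewrite /homRQ; case: xgetP => [p _ /hom_minimizersP[]|/(_ (b, m))//].
case: p => x y /= p_neq0 p_eq.
have y_neq0 : y != 0.
  apply: contraNneq p_neq0 => y0; move/eqP: p_eq.
  by rewrite y0 mulr0 mulf_eq0 (negbTE m_neq0) => /eqP->.
by apply/eqP; rewrite eqr_div // mulrC p_eq.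
Qed.

End HomogeneousRayleighQuotient.

Lemma qform_shift (R : realType) (n : nat) (A B : 'M[R]_n) (u : 'cV[R]_n)
    (t : R) :
  qform ((A - t%:M) *m B) u = qform (A *m B) u - t * qform B u.
Proof.
rewrite /qform mulmxBl mul_scalar_mx mulmxBr mulmxBl -scalemxAr -scalemxAl.
by rewrite !mxE.
Qed.

Theorem proposition3 (R : realType) (n : nat) (A : 'M[R]_n) (u : 'cV[R]_n)
  (A_sym : A^T = A) (uAu_neq0 : qform A u != 0) :
  let alpha := homRQ A u in
  [/\ qform A u * alpha ^+ 2 + ((u^T *m u) 0 0 - qform (A *m A) u) * alpha
        - qform A u = 0,
      0 < alpha * qform A u
    & is_harmonicRQ A u (- alpha^-1) alpha].
Proof.
have [m m_gt0 m_root] :=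
  pos_quadratic_root _ (qform (A *m A) u - (u^T *m u) 0 0) _ uAu_neq0.
rewrite /= (homRQE _ _ _ _ A_sym _ m_gt0 m_root) /is_harmonicRQ qform_shift.
(* A factor [1%:M] lets [qform_shift] expand the denominator as well. *)
rewrite -[A - _]mulmx1 qform_shift mulmx1.
have -> : qform 1%:M u = (u^T *m u) 0 0 by rewrite /qform mulmx1.
have a_ge0 : 0 <= (u^T *m u) 0 0 by rewrite -sqr_enorm sqr_ge0.
move: uAu_neq0 m_root a_ge0.
move: (qform A u) (qform (A *m A) u) ((u^T *m u) 0 0) => b c a b_neq0 m_root a_ge0.
have m_neq0 : m != 0 by rewrite gt_eqF.
have b2_gt0 : 0 < b ^+ 2 by rewrite exprn_even_gt0.
(* Since [- tau = m / b], this is [b] times the harmonic denominator. *)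
have ma_neq0 : b ^+ 2 + m * a != 0.
  by rewrite gt_eqF // ltr_pwDl // mulr_ge0 // ltW.
have den : b - - (b / m)^-1 * a = (b ^+ 2 + m * a) / b by field; apply/andP.
split.
- have -> : b * (b / m) ^+ 2 + (a - c) * (b / m) - b =
      b / m ^+ 2 * (b ^+ 2 - m * (m + (c - a))) by field.
  by rewrite m_root subrr mulr0.
- by rewrite mulrAC -expr2 divr_gt0.
rewrite den; split; first by rewrite mulf_neq0 ?invr_eq0.
have -> : c - - (b / m)^-1 * b = c + m by field; apply/andP.
(* The root equation exhibits the numerator [c + m] as a factor of the denominator, which leaves the
   quotient [b / m]. *)
have mc : b ^+ 2 + m * a = m * (c + m) by rewrite -m_root; ring.
have cm_neq0 : c + m != 0 by apply: contraNneq ma_neq0; rewrite mc => ->; rewrite mulr0.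
by rewrite mc; field; rewrite b_neq0 cm_neq0.
Qed.
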